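(* Let $v \in \mathbb{R}^d$ and let $\mathcal{U} = \{u_1, \cdots, u_k\}$ be an orthonormal set (in $\mathbb{R}^d$) for some $k < d$. Then for any $w \in (\mathrm{span}\,\mathcal{U})^\perp$, $$\Vert v - v^\perp \Vert \le \Vert v - w \Vert,$$ where $v^\perp := v - \sum_{i=1}^k \langle v, u_i\rangle u_i$ denotes the component of $v$ orthogonal to $\mathcal{U}$. Moreover, the angle between $v$ and $v^\perp$ is less than any angle between $v$ and $w$ for $w \in (\mathrm{span}\,\mathcal{U})^\perp$.
   Context: For $v, w \in \mathbb{R}^d$, $\langle v, w \rangle := \sum_{i=1}^d v_i w_i$ is the standard inner product on $\mathbb{R}^d$, and $\Vert \cdot \Vert$ is the associated Euclidean norm. $(\mathrm{span}\,\mathcal{U})^\perp$ is the orthogonal complement of $\mathrm{span}\,\mathcal{U}$ in $\mathbb{R}^d$. The angle $\theta(v,w) \in [0,\pi]$ between $v$ and $w$ is given by $\cos\theta(v,w) := \frac{\langle v, w\rangle}{\Vert v\Vert\,\Vert w\Vert}$.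
   Formalization: ''Less than any angle'' is proved as ''less than or equal to'', since strict inequality fails for w = v^⊥, which itself lies in (span U)^⊥; angles involving a zero vector are taken to be π/2. *)

(* Defs.v *)
From HB Require Import structures.
From mathcomp Require Import all_boot all_order all_algebra.
From mathcomp Require Import sesquilinear.
From mathcomp Require Import reals trigo.

Set Implicit Arguments.
Unset Strict Implicit.
Unset Printing Implicit Defensive.

Import Order.TTheory GRing.Theory Num.Theory.
Local Open Scope ring_scope.

Section Euclidean.
Variables (R : realType) (d : nat).
Implicit Types v w : 'rV[R]_d.

Definition dot v w : R := \sum_(i < d) v 0 i * w 0 i.

Fact dot_bilinear : bilinear_for *%R (idfun \; *%R) dot.
Proof.
split=> [w a u v | u a v w]; rewrite /= /dot mulr_sumr -big_split /=;
  apply: eq_bigr => i _; rewrite !mxE.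
- by rewrite mulrDl mulrA.
- by rewrite mulrDr mulrCA.
Qed.

Fact dot_sym v w : dot v w = (-1) ^+ false * idfun (dot w v).
Proof. by rewrite expr0 mul1r; apply: eq_bigr => i _; rewrite mulrC. Qed.

(* The symmetric form structure is what lets [orthonormal] and [orthov] from
   sesquilinear apply to [dot]. *)
HB.instance Definition _ :=
  @bilinear_isBilinear.Build R 'rV[R]_d 'rV[R]_d R *%R (idfun \; *%R) dot
    dot_bilinear.
HB.instance Definition _ :=
  @isHermitianSesquilinear.Build R 'rV[R]_d false idfun dot dot_sym.

(* Not the norm [`|v|] of analysis on row vectors, which is the sup norm. *)
Definition enorm v : R := Num.sqrt (dot v v).

(* [acos x] is by definition the y in [0, pi] with cos y = x. When v or w is 0
   the quotient is 0, so that [angle v w] is pi / 2. *)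
Definition angle v w : R := acos (dot v w / (enorm v * enorm w)).

Definition orth_part (k : nat) (U : k.-tuple 'rV[R]_d) v : 'rV[R]_d :=
  v - \sum_(i < k) dot v (tnth U i) *: tnth U i.

End Euclidean.

(* Main.v *)
Require Import Defs.
From mathcomp Require Import all_boot all_order all_algebra.
From mathcomp Require Import sesquilinear.
From mathcomp Require Import reals trigo.
From mathcomp Require Import ring.

(** Write [p] for the orthogonal part of [v]: then [v - p] lies in the span of
    [U] and [p] in its orthogonal complement.  For [w] in that complement,
    Pythagoras gives [|v - w|^2 = |v - p|^2 + |p - w|^2], which is the first
    claim.  Also [<v, w> = <p, w> <= |p| |w|] while [<v, p> = |p|^2], so the
    cosine of the angle with [w] is at most [|p| / |v|], the cosine of the
    angle with [p], and [acos] is decreasing. *)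

Import Order.TTheory GRing.Theory Num.Theory.
Local Open Scope ring_scope.

(** Unfolds the recursion inside [orthonormal] into [pairwise], so that orthogonality can be read
    off from two indices. *)
Lemma pair_ortho_recE (R : nzRingType) (eps : bool) (theta : {rmorphism R -> R})
    (V : lmodType R) (form : {hermitian V for eps & theta}) (s : seq V) :
  pair_ortho_rec form s = pairwise (fun u v => form u v == 0) s.
Proof. by elim: s => //= v s <-; rewrite andbT. Qed.

(** Contrapositive of the strict decrease of [cos] on [0, pi], where [acos] takes its values. *)
Lemma le_acos (R : realType) (x y : R) :
  -1 <= x -> x <= y -> y <= 1 -> acos y <= acos x.
Proof.
move=> x_geN1 le_xy y_le1.
have xB : -1 <= x <= 1 by rewrite x_geN1 (le_trans le_xy).
have yB : -1 <= y <= 1 by rewrite y_le1 (le_trans x_geN1).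
rewrite leNgt -ltr_cos ?in_itv/= ?acos_ge0 ?acos_lepi//.
by rewrite !acosK ?in_itv//= -leNgt.
Qed.

Section Dot.
Context {R : realType} {d : nat}.
Implicit Types u v w : 'rV[R]_d.

Lemma dotC v w : dot v w = dot w v.
Proof. by rewrite dot_sym expr0 mul1r. Qed.

Lemma dotNl v w : dot (- v) w = - dot v w.
Proof. exact: linearNl. Qed.

Lemma dotBl u v w : dot (u - v) w = dot u w - dot v w.
Proof. exact: linearBl. Qed.

Lemma dotBr u v w : dot w (u - v) = dot w u - dot w v.
Proof. exact: linearBr. Qed.

Lemma dotZl a v w : dot (a *: v) w = a * dot v w.
Proof. exact: linearZl_LR. Qed.

Lemma dotZr a v w : dot v (a *: w) = a * dot v w.
Proof. exact: linearZr_LR. Qed.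

Lemma dot0l w : dot 0 w = 0. Proof. exact: linear0l. Qed.

Lemma dotvv_ge0 v : 0 <= dot v v.
Proof. by apply: sumr_ge0 => i _; rewrite -expr2 sqr_ge0. Qed.

Lemma dotvv_eq0 v : (dot v v == 0) = (v == 0).
Proof.
apply/idP/eqP => [|->]; last by rewrite dot0l.
rewrite psumr_eq0 => [/allP v0|i _]; last by rewrite -expr2 sqr_ge0.
apply/rowP => i; rewrite mxE.
by have := v0 i (mem_index_enum i); rewrite /= mulf_eq0 orbb => /eqP.
Qed.

Lemma enorm_ge0 v : 0 <= enorm v. Proof. exact: sqrtr_ge0. Qed.

Lemma sqr_enorm v : enorm v ^+ 2 = dot v v.
Proof. by rewrite sqr_sqrtr ?dotvv_ge0. Qed.

Lemma enorm_eq0 v : (enorm v == 0) = (v == 0).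
Proof. by rewrite -dotvv_eq0 -sqr_enorm sqrf_eq0. Qed.

Lemma enormN v : enorm (- v) = enorm v.
Proof. by rewrite /enorm hnormN. Qed.

(** Cauchy-Schwarz: for a = |v| and b = |w|, the square |b v - a w|^2 expands to 2ab(ab - <v, w>).
    It is nonnegative, and 2ab can be cancelled once both vectors are nonzero. *)
Lemma dot_le_enorm v w : dot v w <= enorm v * enorm w.
Proof.
have [->|v0] := eqVneq v 0; first by rewrite dot0l mulr_ge0 ?enorm_ge0.
have [->|w0] := eqVneq w 0; first by rewrite dotC dot0l mulr_ge0 ?enorm_ge0.
have vw_gt0 : 0 < 2 * (enorm v * enorm w).
  by rewrite !mulr_gt0// lt_def enorm_ge0 enorm_eq0 ?v0 ?w0.
have := dotvv_ge0 (enorm w *: v - enorm v *: w).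
rewrite dotBl !dotBr !dotZl !dotZr -!sqr_enorm (dotC w v).
set a := enorm v in vw_gt0 *; set b := enorm w in vw_gt0 *.
rewrite [leRHS](_ : _ = 2 * (a * b) * (a * b - dot v w)); last by ring.
by rewrite pmulr_rge0// subr_ge0.
Qed.

Lemma norm_dot_le v w : `|dot v w| <= enorm v * enorm w.
Proof.
rewrite ler_norml dot_le_enorm andbT lerNl.
by rewrite -dotNl -(enormN v) dot_le_enorm.
Qed.

(** Places the quotient in the interval where [acos] inverts [cos]. For a zero vector the division
    by zero returns 0. *)
Lemma norm_cos_angle_le1 v w : `|dot v w / (enorm v * enorm w)| <= 1.
Proof.
have vw_ge0 : 0 <= enorm v * enorm w by rewrite mulr_ge0 ?enorm_ge0.
have [vw0|vw0] := eqVneq (enorm v * enorm w) 0.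
  by rewrite vw0 invr0 mulr0 normr0.
rewrite normrM normfV (ger0_norm vw_ge0) ler_pdivrMr ?mul1r ?norm_dot_le//.
by rewrite lt_def vw0.
Qed.

Lemma dot_tnth_orthonormal {k : nat} (U : k.-tuple 'rV[R]_d) (i j : 'I_k) :
  orthonormal (@dot R d) U -> dot (tnth U i) (tnth U j) = (i == j)%:R.
Proof.
case/andP=> /allP U1; rewrite pair_ortho_recE => /(pairwiseP 0) U0.
(* [pairwise] speaks of increasing indices only; symmetry of [dot] gives the other order. *)
have lt_dot (a b : 'I_k) : (a < b)%N -> dot (tnth U a) (tnth U b) = 0.
  by move=> ab; apply/eqP; rewrite !(tnth_nth 0) U0 ?inE ?size_tuple.
have [<-|] := eqVneq i j; first exact/eqP/U1/mem_tnth.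
rewrite neq_ltn => /orP[/lt_dot//|/lt_dot ji0].
by rewrite dotC.
Qed.

Section OrthPart.
Context {k : nat} (U : k.-tuple 'rV[R]_d).

Lemma sub_orth_part_span v : v - orth_part U v \in <<U>>%VS.
Proof.
rewrite opprB addrC subrK rpred_sum// => i _.
by rewrite rpredZ// memv_span// mem_tnth.
Qed.

(** It suffices to test against each generator u_j, where orthonormality reduces the sum to <v,
    u_j>, which cancels. *)
Lemma orth_part_orthov v :
  orthonormal (@dot R d) U -> orth_part U v \in orthov (@dot R d) <<U>>%VS.
Proof.
move=> hU; rewrite mem_orthov_sym; apply/span_subvP => _ /tnthP[j ->].
rewrite mem_orthov1 /= dotC dotBl linear_sumlz (bigD1 j)//= big1 => [|i neq_ij].
  by rewrite dotZl dot_tnth_orthonormal// eqxx mulr1 addr0 subrr.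
by rewrite dotZl dot_tnth_orthonormal// (negPf neq_ij) mulr0.
Qed.

Lemma dot_orth_part v w :
  w \in orthov (@dot R d) <<U>>%VS -> dot v w = dot (orth_part U v) w.
Proof.
move=> /mem_orthovP /(_ _ (sub_orth_part_span v)).
by rewrite /= dotC dotBl => /subr0_eq.
Qed.

End OrthPart.
End Dot.

Theorem lemma3p1 (R : realType) (d k : nat) (hkd : (k < d)%N)
    (v : 'rV[R]_d) (U : k.-tuple 'rV[R]_d)
    (hU : orthonormal (@dot R d) U) :
  (forall w : 'rV[R]_d, w \in orthov (@dot R d) <<U>>%VS ->
     enorm (v - orth_part U v) <= enorm (v - w)) /\
  (forall w : 'rV[R]_d, w \in orthov (@dot R d) <<U>>%VS ->
     angle v (orth_part U v) <= angle v w).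
Proof.
(* Taking w = p, which lies in the complement, yields <v, p> = <p, p>. *)
have vp := dot_orth_part U v _ (orth_part_orthov U v hU).
(* From here on p is an arbitrary vector with <v, p> = <p, p> and <v, w> = <p, w>; both claims
   follow from these two equations. *)
split=> w /(dot_orth_part U v); move: (orth_part U v) vp => p vp vw.
  rewrite /enorm ler_sqrt ?dotvv_ge0// -subr_ge0.
  have -> : dot (v - w) (v - w) - dot (v - p) (v - p) = dot (p - w) (p - w).
    rewrite !dotBl !dotBr (dotC w v) (dotC p v) (dotC w p) vp vw; ring.
  exact: dotvv_ge0.
have /andP[vw_geN1 _] : -1 <= dot v w / (enorm v * enorm w) <= 1.
  by rewrite -ler_norml norm_cos_angle_le1.
have /andP[_ vp_le1] : -1 <= dot v p / (enorm v * enorm p) <= 1.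
  by rewrite -ler_norml norm_cos_angle_le1.
apply: le_acos => //; rewrite vp vw -sqr_enorm.
(* Also true for p = 0 or v = 0, where both sides are 0. *)
have -> : enorm p ^+ 2 / (enorm v * enorm p) = enorm p / enorm v.
  have [->|p0] := eqVneq (enorm p) 0; first by rewrite expr0n !mul0r.
  by rewrite expr2 invfM -mulrA [X in _ * X]mulrCA divff// mulr1.
(* With the common factor 1/|v| removed, <p, w> / |w| <= |p| remains: Cauchy-Schwarz, or 0 <= |p| if
   w = 0. *)
rewrite invfM mulrA mulrAC ler_wpM2r ?invr_ge0 ?enorm_ge0//.
have [->|w0] := eqVneq w 0; first by rewrite dotC dot0l mul0r enorm_ge0.
by rewrite ler_pdivrMr ?dot_le_enorm// lt_def enorm_eq0 w0 enorm_ge0.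
Qed.
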